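(* The double arrow space $\mathbb{D}$ is $\mathsf{ro}$-stratifiable, but it is not $\varkappa$-metrizable.
   Context: The double arrow space is $\mathbb{D}=[0,1]\times\{0,1\}$ with the order topology of the lexicographic order. A subset $U$ of a topological space $X$ is regular open if $U=\operatorname{int}\operatorname{cl}U$; $\operatorname{RO}(X)$ is the family of all regular open subsets of $X$. For a family of functions $\{f_U\colon U\in\operatorname{RO}(X)\}$, $f_U\colon X\to[0,1]$, consider the conditions: (1) $U=f_U^{-1}((0,1])$ for every $U\in\operatorname{RO}(X)$; (2) if $U,V\in\operatorname{RO}(X)$ and $U\subseteq V$, then $f_U(x)\leqslant f_V(x)$ for every $x\in X$; (3) each $f_U$ is continuous; (4) if $(U^\alpha)$ is a decreasing (possibly transfinite) sequence of regular open sets and $W=\operatorname{int}\bigcap_\alpha U^\alpha$, then $f_W(x)=\inf_\alpha f_{U^\alpha}(x)$ for every $x\in X$. A $T_0$-space $X$ is $\mathsf{ro}$-stratifiable if there is such a family satisfying (1)--(3). A $T_0$-space $X$ is $\varkappa$-metrizable if $\operatorname{RO}(X)$ is a base of $X$ and there is such a family satisfying (1)--(4). *)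

(* Defs.v *)
From HB Require Import structures.
From mathcomp Require Import all_boot all_order all_algebra.
From mathcomp Require Import wochoice all_classical all_reals all_analysis.

Set Implicit Arguments.
Unset Strict Implicit.
Unset Printing Implicit Defensive.

Import Order.TTheory GRing.Theory Num.Theory.
Import numFieldNormedType.Exports.

Local Open Scope classical_set_scope.
Local Open Scope ring_scope.

Definition unit_interval (R : realType) : Type := {x : R | 0 <= x <= 1}.

HB.instance Definition _ (R : realType) := SubType.on (unit_interval R).
HB.instance Definition _ (R : realType) := Choice.on (unit_interval R).
HB.instance Definition _ (R : realType) :=
  [SubChoice_isSubOrder of unit_interval R by <: with ring_display].

(* [bool] is ordered by [false < true], so it plays the role of [{0, 1}];
   [*l] is the product with the lexicographic order. *)
Definition double_arrow (R : realType) : topologicalType :=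
  order_topology (unit_interval R *l bool)%type.

(* The family [f_U] is a function on all sets, of which only the values at
   regular open sets are constrained. *)
Definition ro_family (R : realType) (X : topologicalType)
    (f : set X -> X -> R) : Prop :=
  forall U, regopen U -> forall x, f U x \in `[0, 1].

Definition ro_positive (R : realType) (X : topologicalType)
    (f : set X -> X -> R) : Prop :=
  forall U, regopen U -> U = f U @^-1` `]0, 1].

Definition ro_monotone (R : realType) (X : topologicalType)
    (f : set X -> X -> R) : Prop :=
  forall U V, regopen U -> regopen V -> U `<=` V -> forall x, f U x <= f V x.

Definition ro_continuous (R : realType) (X : topologicalType)
    (f : set X -> X -> R) : Prop :=
  forall U, regopen U -> continuous (f U).

(* A transfinite sequence is a family indexed by a well-ordered type; it is
   taken to be nonempty. *)
Definition ro_inf_continuous (R : realType) (X : topologicalType)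
    (f : set X -> X -> R) : Prop :=
  forall (I : Type) (leI : rel I) (U : I -> set X),
    inhabited I -> well_order leI ->
    (forall i, regopen (U i)) ->
    (forall i j, leI i j -> U j `<=` U i) ->
    forall x, f ((\bigcap_i U i)°) x = inf (range (fun i => f (U i) x)).

Definition ro_stratifiable (R : realType) (X : topologicalType) : Prop :=
  kolmogorov_space X /\
  exists f : set X -> X -> R,
    [/\ ro_family f, ro_positive f, ro_monotone f & ro_continuous f].

Definition kappa_metrizable (R : realType) (X : topologicalType) : Prop :=
  [/\ kolmogorov_space X,
      basis [set U : set X | regopen U] &
      exists f : set X -> X -> R,
        [/\ ro_family f, ro_positive f, ro_monotone f, ro_continuous f &
            ro_inf_continuous f]].

(* Main.v *)
Require Import Defs.
From mathcomp Require Import all_boot all_order all_algebra.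
From mathcomp Require Import wochoice all_classical all_reals all_analysis.
From mathcomp Require Import lra.

(** A regular open set [U] of the double arrow space splits into its maximal
    convex parts.  Giving every point of such a part the length of that part
    (and [0] to points outside [U]) defines [f_U]: it is monotone in [U] and
    locally constant on [U].  At [p] outside [U], regularity of [U] yields
    points [z <> p] outside [U] in every one-sided neighbourhood of a
    non-isolated [p]; the parts meeting the interval between [p] and [z] lie
    inside it, so they are short and [f_U] tends to [0] at [p].

    Against kappa-metrizability, let [L_x] be the clopen set of the points
    below [(x, 1)].  By (3) there are rationals [0 < c] and [q < x] with
    [f_(L_x) > c] on the part of [L_x] to the right of [q], and by (4), as
    [L_x] is the interior of the intersection of the [L_y] with [x < y], there
    is a rational [r > x] with [f_(L_r) (x, 1) < c].  If [x < y] share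
    [(c, q, r)], then [c < f_(L_y) (x, 1) <= f_(L_r) (x, 1) < c]; so
    [x |-> (c, q, r)] would inject an interval into a countable set. *)

Set Implicit Arguments.
Unset Strict Implicit.
Unset Printing Implicit Defensive.

Import Order.TTheory GRing.Theory Num.Theory.
Import numFieldNormedType.Exports.

Local Open Scope classical_set_scope.
Local Open Scope ring_scope.

(** * Lengths of convex parts of a set in an ordered space *)

Section extent.
Context {R : realType} {d : Order.disp_t} {T : orderTopologicalType d}.
Context (l r : T -> R).
Implicit Types (U : set T) (p q u v w : T).

(** A maximal convex part of [U] may lack endpoints, so its length is approached through the closed
    intervals inside it. Two scales [l] and [r] measure left and right ends, so that even a
    one-point interval can have positive length. *)
Definition spans U p : set R :=
  [set t | exists u v, [/\ (u <= p <= v)%O, `[u, v]%classic `<=` U &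
                           t = r v - l u]].

Definition extent U p : R := sup (spans U p).

Context (l_nondecreasing : {homo l : u v / (u <= v)%O >-> u <= v})
  (r_nondecreasing : {homo r : u v / (u <= v)%O >-> u <= v})
  (span01 : forall u v, (u <= v)%O -> 0 <= r v - l u <= 1).

Lemma span_le_extent U p u v :
  (u <= p <= v)%O -> `[u, v]%classic `<=` U -> r v - l u <= extent U p.
Proof.
move=> upv uvU; apply: ub_le_sup; last by exists u, v.
exists 1 => _ [u' [v' [/andP[u'p pv'] _ ->]]].
by have /andP[] := span01 (le_trans u'p pv').
Qed.

(** Nonnegativity of [x] covers [p] outside [U]: there are then no spans, and [sup set0] is [0]. *)
Lemma extent_le U p x : 0 <= x ->
  (forall u v, (u <= p <= v)%O -> `[u, v]%classic `<=` U -> r v - l u <= x) ->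
  extent U p <= x.
Proof.
move=> x0 H; rewrite /extent.
have [->|/set0P ne] := eqVneq (spans U p) set0; first by rewrite sup0.
by apply: ge_sup => // _ [u [v [upv uvU ->]]]; exact: H.
Qed.

Lemma extent_ge0 U p : 0 <= extent U p.
Proof.
rewrite /extent; have [->|/set0P[_ [u [v [upv uvU _]]]]] :=
  eqVneq (spans U p) set0; first by rewrite sup0.
have /andP[up pv] := upv; have /andP[vu0 _] := span01 (le_trans up pv).
exact: le_trans vu0 (span_le_extent upv uvU).
Qed.

Lemma extent_le1 U p : extent U p <= 1.
Proof.
apply: extent_le => // u v /andP[up pv] _.
by have /andP[] := span01 (le_trans up pv).
Qed.

Lemma extent_subset U V p : U `<=` V -> extent U p <= extent V p.
Proof.
move=> UV; apply: extent_le => [|u v upv uvU]; first exact: extent_ge0.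
by apply: span_le_extent => //; exact: subset_trans UV.
Qed.

Lemma extent_notin U p : ~ U p -> extent U p = 0.
Proof.
move=> nUp; apply/eqP; rewrite eq_le extent_ge0 andbT.
apply: extent_le => // u v upv uvU; exfalso; apply: nUp; apply: uvU.
by rewrite /= in_itv.
Qed.

(** An interval [[u, v]] in [U] around [p] meets [[a, b]] at [p], so their union is an interval in
    [U]; it contains [q] and is at least as long. Exchanging [p] and [q] shows that [extent U] is
    constant on [[a, b]]. *)
Lemma extent_le_itv U a b p q : `[a, b]%classic `<=` U ->
  p \in `[a, b] -> q \in `[a, b] -> extent U p <= extent U q.
Proof.
rewrite !in_itv/= => abU /andP[ap pb] /andP[aq qb].
apply: extent_le => [|u v /andP[up pv] uvU]; first exact: extent_ge0.
have : r v - l u <= r (Order.max v b) - l (Order.min u a).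
  by apply: lerB; [apply: r_nondecreasing; rewrite le_max lexx|
                   apply: l_nondecreasing; rewrite ge_min lexx].
move=> /le_trans; apply; apply: span_le_extent.
  by rewrite ge_min aq orbT le_max qb orbT.
move=> w /=; rewrite in_itv/= ge_min le_max => /andP[uaw wvb].
have [wa|aw] := ltP w a.
  apply: uvU; rewrite /= in_itv/=; apply/andP; split.
    by move: uaw; rewrite leNgt [(a <= w)%O]leNgt wa orbF -leNgt.
  exact: le_trans (ltW wa) (le_trans ap pv).
have [bw|wb] := ltP b w; last by apply: abU; rewrite /= in_itv/= aw.
apply: uvU; rewrite /= in_itv/=; apply/andP; split.
  exact: le_trans up (le_trans pb (ltW bw)).
by move: wvb; rewrite [(w <= b)%O]leNgt bw orbF.
Qed.

(* A point has arbitrarily small one-sided clopen interval neighbourhoods; the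
   alternative [a = b] covers isolated points. *)
Context (one_sided : forall p (O : set T) e, nbhs p O -> 0 < e ->
  exists a b, [/\ p = a \/ p = b, (a <= b)%O, open `[a, b]%classic,
    `[a, b]%classic `<=` O &
    0 < r b - l a /\ (r b - l a <= e \/ a = b)]).

Lemma extent_gt0 U p : open U -> U p -> 0 < extent U p.
Proof.
move=> oU Up; have nU : nbhs p U by exact: open_nbhs_nbhs.
have [a [b [pab ab _ abU [ba0 _]]]] := one_sided nU ltr01.
apply: (lt_le_trans ba0); apply: span_le_extent => //.
by case: pab => ->; rewrite lexx ab.
Qed.

Lemma extent_continuous U : regopen U -> continuous (extent U).
Proof.
move=> rU p; have [Up|nUp] := pselect (U p).
  have nU : nbhs p U.
    by apply: open_nbhs_nbhs; split => //; rewrite -rU; exact: open_interior.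
  have [a [b [pab ab oab abU _]]] := one_sided nU ltr01.
  have pab' : p \in `[a, b] by rewrite in_itv/=; case: pab => ->; rewrite lexx ab.
  apply/cvgrPdist_le => e e0.
  have : nbhs p `[a, b]%classic by exact: open_nbhs_nbhs.
  apply: filterS => q qab.
  suff -> : extent U q = extent U p by rewrite subrr normr0 ltW.
  by apply/eqP; rewrite eq_le !(extent_le_itv abU).
apply/cvgrPdist_le => e e0; rewrite extent_notin//.
have [a [b [pab ab oab _ [_ small]]]] := one_sided (@filterT _ (nbhs p) _) e0.
have pab' : p \in `[a, b] by rewrite in_itv/=; case: pab => ->; rewrite lexx ab.
have nab : nbhs p `[a, b]%classic by exact: open_nbhs_nbhs.
suff [N nN HN] : exists2 N, nbhs p N & forall q, N q -> extent U q <= e.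
  by apply: filterS nN => q Nq; rewrite sub0r normrN ger0_norm ?extent_ge0 ?HN.
(* If [p] is isolated, [[set p]] is the required neighbourhood; otherwise [a = b] is impossible. *)
have [op|nop] := pselect (nbhs p [set p]).
  by exists [set p] => // q ->; rewrite extent_notin// ltW.
have {}small : r b - l a <= e.
  case: small => // ab'; exfalso; apply: nop.
  by move: nab; rewrite -ab' set_itv1; case: pab => ->; rewrite // ab'.
(* Otherwise [U] contains [[a, b]] except for [p]. As [p] is not isolated, it lies in the closure of
   [U], so the neighbourhood [[a, b]] of [p] lies in that closure, and regularity puts [p] in
   [U]. *)
have [z [zab zp nUz]] : exists z, [/\ z \in `[a, b], z != p & ~ U z].
  apply: contrapT => nz; apply: nUp; rewrite -rU /interior.
  have abU q : q \in `[a, b] -> q != p -> U q.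
    by move=> qab qp; apply: contrapT => nUq; apply: nz; exists q.
  apply: filterS (nab) => q qab B Bq.
  have [qp|qp] := eqVneq q p; last first.
    by exists q; split; [exact: abU|exact: nbhs_singleton].
  have [w [[Bw wab] wp]] : exists w, (B `&` `[a, b]%classic) w /\ w != p.
    apply: contrapT => nw; apply: nop.
    have : nbhs p (B `&` `[a, b]%classic).
      by apply: filterI => //; rewrite -qp.
    by apply: filterS => w Hw; apply: contrapT => /eqP wp; apply: nw; exists w.
  by exists w; split => //; exact: abU.
have bound u v : (a <= u)%O -> (v <= b)%O -> r v - l u <= e.
  move=> au vb; apply: le_trans small.
  by apply: lerB; [exact: r_nondecreasing|exact: l_nondecreasing].
move: (zab); rewrite in_itv/= => /andP[az zb].
(* For [q] between [p] and [z], an interval in [U] around [q] can pass neither of these two points,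
   so it stays inside [[a, b]] and [bound] applies. *)
case: pab => pE; subst p.
- have {}zp : (a < z)%O by rewrite lt_neqAle eq_sym zp.
  exists (`[a, b]%classic `&` `]-oo, z[%classic).
    apply: filterI => //; apply: open_nbhs_nbhs; split; first exact: lray_open.
    by rewrite /= in_itv.
  move=> q [/= + qz]; rewrite !in_itv/= in qz * => /andP[aq qb].
  apply: extent_le => [|u v /andP[uq qv] uvU]; first exact: ltW.
  apply: bound => //.
    rewrite leNgt; apply/negP => ua; apply: nUp; apply: uvU.
    by rewrite /= in_itv/= (ltW ua) (le_trans aq qv).
  apply: le_trans zb; rewrite leNgt; apply/negP => zv; apply: nUz; apply: uvU.
  by rewrite /= in_itv/= (ltW zv) (le_trans uq (ltW qz)).
- have {}zp : (z < b)%O by rewrite lt_neqAle zp.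
  exists (`[a, b]%classic `&` `]z, +oo[%classic).
    apply: filterI => //; apply: open_nbhs_nbhs; split; first exact: rray_open.
    by rewrite /= in_itv/= andbT.
  move=> q [/= + zq]; rewrite !in_itv/= andbT in zq * => /andP[aq qb].
  apply: extent_le => [|u v /andP[uq qv] uvU]; first exact: ltW.
  apply: bound => //.
    apply: le_trans az _; rewrite leNgt; apply/negP => uz; apply: nUz.
    by apply: uvU; rewrite /= in_itv/= (ltW uz) (le_trans (ltW zq) qv).
  rewrite leNgt; apply/negP => bv; apply: nUp; apply: uvU.
  by rewrite /= in_itv/= (ltW bv) (le_trans uq qb).
Qed.

End extent.

(** * One-sided neighbourhoods in an order topology *)

Section order_nbhs.
Context {d : Order.disp_t} {T : orderTopologicalType d}.
Implicit Types (p q w : T).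

(** The point [q] shows that [p] is not the maximum; it also serves as [w] when the basic interval
    around [p] is unbounded on the right. *)
Lemma nbhs_sub_itvco p q (O : set T) : nbhs p O -> (p < q)%O ->
  exists2 w, (p < w)%O & `[p, w[%classic `<=` O.
Proof.
rewrite itv_nbhsE => -[[i [b w|c]] [oi pi] iO] pq; last first.
  rewrite (itv_open_ends_rinfty oi) in pi iO.
  exists q => // z /=; rewrite in_itv/= => /andP[pz _]; apply: iO => /=.
  move: pi; rewrite !itv_boundlr => /andP[ip _].
  by rewrite (le_trans ip)//= leEsub.
rewrite (itv_open_ends_rside oi) in pi iO.
move: (pi); rewrite itv_boundlr => /andP[ip pw].
exists w; first by rewrite -[(p < w)%O]/(BRight p <= BLeft w)%O.
move=> z /=; rewrite in_itv/= => /andP[pz zw]; apply: iO => /=.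
by rewrite itv_boundlr (le_trans ip).
Qed.

Lemma nbhs_sub_itvoc p q (O : set T) : nbhs p O -> (q < p)%O ->
  exists2 w, (w < p)%O & `]w, p]%classic `<=` O.
Proof.
rewrite itv_nbhsE => -[[[b w|c] i] [oi pi] iO] qp; last first.
  rewrite (itv_open_ends_linfty oi) in pi iO.
  exists q => // z /=; rewrite in_itv/= => /andP[_ zp]; apply: iO => /=.
  move: pi; rewrite !itv_boundlr => /andP[_ ip].
  by rewrite (le_trans _ ip).
rewrite (itv_open_ends_lside oi) in pi iO.
move: (pi); rewrite itv_boundlr => /andP[wp ip].
exists w; first by rewrite -[(w < p)%O]/(BRight w <= BLeft p)%O.
move=> z /=; rewrite in_itv/= => /andP[wz zp]; apply: iO => /=.
by rewrite itv_boundlr/= (le_trans _ ip)// andbT.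
Qed.

End order_nbhs.

(** * The double arrow space is ro-stratifiable *)

Section double_arrow_order.
Context {R : realType}.
Local Notation D := (order_topology (unit_interval R *l bool)%type).
Implicit Types p q : D.

Definition coordinate p : R := val (p : unit_interval R * bool).1.

Definition side p : bool := (p : unit_interval R * bool).2.

Definition arrow_point (x : R) (x01 : 0 <= x <= 1) (s : bool) : D :=
  (exist _ x x01 : unit_interval R, s).

Lemma coordinate01 p : 0 <= coordinate p <= 1.
Proof. exact: (valP (p : unit_interval R * bool).1). Qed.

Lemma arrow_eq p q : coordinate p = coordinate q -> side p = side q -> p = q.
Proof.
by case: p q => [x b] [y c]; rewrite /coordinate /side/= => /val_inj -> ->.
Qed.

Lemma arrow_le p q : (p <= q)%O =
  (coordinate p < coordinate q) ||
  (coordinate p == coordinate q) && (side p ==> side q).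
Proof.
case: p q => [x b] [y c].
rewrite [LHS]Order.ProdLexiOrder.leEprodlexi /coordinate /side/= !leEsub leEbool.
by case: (ltgtP (val x) (val y)) => //=; case: b; case: c.
Qed.

Lemma arrow_lt p q : (p < q)%O =
  (coordinate p < coordinate q) ||
  (coordinate p == coordinate q) && (~~ side p && side q).
Proof.
rewrite ltNge arrow_le negb_or negb_and.
by case: (ltgtP (coordinate p) (coordinate q)); case: (side p); case: (side q).
Qed.

Lemma coordinate_le p q : (p <= q)%O -> coordinate p <= coordinate q.
Proof. by rewrite arrow_le => /orP[/ltW//|/andP[/eqP-> _]]. Qed.

(* The minimum and the maximum are isolated, hence may be maximal convex parts
   of zero length; the extra length given to them keeps [f_U] positive. *)
Definition left_scale p : R :=
  if (coordinate p == 0) && ~~ side p then 0 else (1 + coordinate p) / 3.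

Definition right_scale p : R :=
  if (coordinate p == 1) && side p then 1 else (1 + coordinate p) / 3.

Lemma left_scale_nondecreasing :
  {homo left_scale : p q / (p <= q)%O >-> p <= q}.
Proof.
move=> p q pq; have /andP[p0 p1] := coordinate01 p; have := coordinate_le pq.
rewrite /left_scale; case: ifPn => [_|np]; first by case: ifPn; lra.
case: ifPn => [/andP[/eqP q0 sq]|_]; last by lra.
move: pq np; rewrite arrow_le q0 ltNge p0/= (negbTE sq) implybF.
by move=> ->.
Qed.

Lemma right_scale_nondecreasing :
  {homo right_scale : p q / (p <= q)%O >-> p <= q}.
Proof.
move=> p q pq; have /andP[q0 q1] := coordinate01 q; have := coordinate_le pq.
rewrite /right_scale; case: (ifPn (_ && side q)) => [_|nq].
  by case: ifPn; lra.
case: ifPn => [/andP[/eqP p1 sp]|_]; last by lra.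
move: pq nq; rewrite arrow_le p1 ltNge q1/= sp/= eq_sym.
by move=> ->.
Qed.

(** The map [(1 + x) / 3] takes [[0, 1]] onto [[1/3, 2/3]], which leaves [1/3] on either side for
    the exceptional values [0] and [1]. *)
Lemma scale_span01 p q : (p <= q)%O -> 0 <= right_scale q - left_scale p <= 1.
Proof.
move=> /coordinate_le; have := coordinate01 p; have := coordinate01 q.
by rewrite /left_scale /right_scale; case: ifPn; case: ifPn; lra.
Qed.

Lemma arrow_pointE p : p = arrow_point (coordinate01 p) (side p).
Proof. exact: arrow_eq. Qed.

Lemma coordinate_point x (x01 : 0 <= x <= 1) s :
  coordinate (arrow_point x01 s) = x.
Proof. by []. Qed.

Lemma side_point x (x01 : 0 <= x <= 1) s : side (arrow_point x01 s) = s.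
Proof. by []. Qed.

Definition pointE := (coordinate_point, side_point).

Lemma arrow_itv_open x y (x01 : 0 <= x <= 1) (y01 : 0 <= y <= 1) :
  open `[arrow_point x01 true, arrow_point y01 false]%classic.
Proof.
(* [true <= b] and [false < b] compute to the same boolean, which makes the
   closed interval convertible to the open one. *)
exact: (itv_open (arrow_point x01 false) (arrow_point y01 true)).
Qed.

Lemma arrow_point_min_open (x01 : 0 <= (0 : R) <= 1) :
  open [set arrow_point x01 false].
Proof.
suff -> : [set arrow_point x01 false] = `]-oo, arrow_point x01 true[%classic.
  exact: lray_open.
apply/seteqP; split => q; rewrite /= in_itv/= arrow_lt !pointE andbT.
  by move=> ->; rewrite !pointE eqxx orbT.
rewrite ltNge; have /andP[-> _]/= := coordinate01 q; move=> /andP[/eqP q0 sq].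
by apply: arrow_eq; rewrite !pointE//; exact: negbTE.
Qed.

Lemma arrow_point_max_open (x01 : 0 <= (1 : R) <= 1) :
  open [set arrow_point x01 true].
Proof.
suff -> : [set arrow_point x01 true] = `]arrow_point x01 false, +oo[%classic.
  exact: rray_open.
apply/seteqP; split => q; rewrite /= in_itv/= arrow_lt !pointE andbT/=.
  by move=> ->; rewrite !pointE eqxx orbT.
rewrite ltNge; have /andP[_ ->]/= := coordinate01 q => /andP[/eqP q1 sq].
exact: arrow_eq.
Qed.

(** Because of the jump from [(x, 0)] to [(x, 1)], the point [(x, 1)] is approached only from the
    right and [(x, 0)] only from the left. The extreme points [(1, 1)] and [(0, 0)] are isolated and
    have length [1/3]. *)
Lemma arrow_one_sided p (O : set D) e : nbhs p O -> 0 < e ->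
  exists a b, [/\ p = a \/ p = b, (a <= b)%O, open `[a, b]%classic,
    `[a, b]%classic `<=` O &
    0 < right_scale b - left_scale a /\
    (right_scale b - left_scale a <= e \/ a = b)].
Proof.
rewrite [p]arrow_pointE; move: (coordinate p) (coordinate01 p) => x x01.
case: (side p) => pO e0.
- have [x1|x1] := eqVneq x 1.
    subst x; exists (arrow_point x01 true), (arrow_point x01 true); split => //.
    + by left.
    + by rewrite set_itv1; exact: arrow_point_max_open.
    + by rewrite set_itv1 => _ ->; exact: nbhs_singleton.
    + split; last by right.
      by rewrite /left_scale /right_scale !pointE eqxx/= andbF; lra.
  have l01 : 0 <= (1 : R) <= 1 by rewrite ler01 lexx.
  have [|w xw wO] := @nbhs_sub_itvco _ _ _ (arrow_point l01 true) _ pO.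
    by have /andP[_ xle1] := x01; rewrite arrow_lt !pointE lt_neqAle x1 xle1.
  have {}xw : x < coordinate w by move: xw; rewrite arrow_lt !pointE/= andbF orbF.
  have w01 := coordinate01 w.
  (* The bound by [coordinate w] keeps the interval inside [O]; the bound by [x + e] makes its
     length [(y - x) / 3] at most [e]. *)
  have [y [xy yw ye]] : exists y, [/\ x < y, y < coordinate w & y < x + e].
    exists ((x + Num.min (coordinate w) (x + e)) / 2).
    by case: (leP (coordinate w) (x + e)); split; lra.
  have y01 : 0 <= y <= 1 by lra.
  exists (arrow_point x01 true), (arrow_point y01 false); split.
  + by left.
  + by rewrite arrow_le !pointE xy.
  + exact: arrow_itv_open.
  + apply: subset_trans wO => q; rewrite /= !in_itv/= => /andP[-> /coordinate_le].
    by rewrite pointE arrow_lt => qy; rewrite (le_lt_trans qy yw).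
  + by rewrite /left_scale /right_scale !pointE !andbF; split; [|left]; lra.
- have [x0|x0] := eqVneq x 0.
    subst x; exists (arrow_point x01 false), (arrow_point x01 false); split => //.
    + by left.
    + by rewrite set_itv1; exact: arrow_point_min_open.
    + by rewrite set_itv1 => _ ->; exact: nbhs_singleton.
    + split; last by right.
      by rewrite /left_scale /right_scale !pointE eqxx/= andbF; lra.
  have l01 : 0 <= (0 : R) <= 1 by rewrite ler01 lexx.
  have [|w wx wO] := @nbhs_sub_itvoc _ _ _ (arrow_point l01 false) _ pO.
    by have /andP[xge0 _] := x01; rewrite arrow_lt !pointE lt_neqAle eq_sym x0 xge0.
  have {}wx : coordinate w < x by move: wx; rewrite arrow_lt !pointE/= !andbF orbF.
  have w01 := coordinate01 w.
  have [y [yx wy ye]] : exists y, [/\ y < x, coordinate w < y & x - e < y].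
    exists ((x + Num.max (coordinate w) (x - e)) / 2).
    by case: (leP (coordinate w) (x - e)); split; lra.
  have y01 : 0 <= y <= 1 by lra.
  exists (arrow_point y01 true), (arrow_point x01 false); split.
  + by right.
  + by rewrite arrow_le !pointE yx.
  + exact: arrow_itv_open.
  + apply: subset_trans wO => q; rewrite /= !in_itv/= => /andP[/coordinate_le + ->].
    by rewrite pointE arrow_lt => yq; rewrite (lt_le_trans wy yq).
  + by rewrite /left_scale /right_scale !pointE !andbF; split; [|left]; lra.
Qed.

Lemma double_arrow_kolmogorov : kolmogorov_space (double_arrow R).
Proof.
apply: accessible_kolmogorov; apply: hausdorff_accessible.
exact: (@order_hausdorff _ D).
Qed.

Theorem double_arrow_ro_stratifiable : ro_stratifiable R (double_arrow R).
Proof.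
split; first exact: double_arrow_kolmogorov.
have rE := right_scale_nondecreasing; have lE := left_scale_nondecreasing.
pose f : set D -> D -> R := extent left_scale right_scale.
exists f; split.
- by move=> U _ x; rewrite in_itv/= extent_ge0 ?extent_le1//; exact: scale_span01.
- move=> U rU; apply/seteqP; split => x; rewrite /= in_itv/=.
    move=> Ux; rewrite extent_le1 ?andbT; last exact: scale_span01.
    apply: (extent_gt0 scale_span01 arrow_one_sided) Ux.
    by rewrite -rU; exact: open_interior.
  move=> /andP[fx0 _]; apply: contrapT => nUx; move: fx0.
  by rewrite /f (extent_notin scale_span01 nUx) ltxx.
- by move=> U V _ _ UV x; exact: (extent_subset scale_span01).
- by move=> U rU; exact: (extent_continuous lE rE scale_span01 arrow_one_sided).
Qed.

End double_arrow_order.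

(** A choice of [t] for each [x] that never repeated a value would make []0, 1[] countable, hence of
    Lebesgue measure [0] instead of [1]. *)
Lemma uncountable_itv01_choice (R : realType) (T : countType)
    (P : R -> T -> Prop) :
  (forall x, 0 < x < 1 -> exists t, P x t) ->
  exists x y t, [/\ 0 < x < 1, 0 < y < 1, x < y, P x t & P y t].
Proof.
move=> exP; apply: contrapT => noP.
have half01 : 0 < (2^-1 : R) < 1 by lra.
have [t0 _] := exP _ half01.
have /choice[g gP] : forall x, exists t, 0 < x < 1 -> P x t.
  move=> x; have [x01|nx] := pselect (0 < x < 1); last by exists t0.
  by have [t Pt] := exP _ x01; exists t.
have : countable (`]0, 1[%classic : set R).
  apply/countable_injP; exists (choice.pickle \o g) => x y.
  rewrite !inE /= !in_itv/= => x01 y01 /(pcan_inj choice.pickleK) gxy.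
  have [xy|yx|//] := ltgtP x y; exfalso; apply: noP.
    by exists x, y, (g y); split => //; [rewrite -gxy|]; exact: gP.
  by exists y, x, (g x); split => //; [rewrite gxy|]; exact: gP.
move=> /countable_lebesgue_measure0; rewrite lebesgue_measure_itv/= lte_fin ltr01.
by rewrite -EFinB subr0 => /eqP; rewrite eqe oner_eq0.
Qed.

(** * The double arrow space is not kappa-metrizable *)

Section not_kappa_metrizable.
Context {R : realType}.
Local Notation D := (order_topology (unit_interval R *l bool)%type).
Implicit Types (p q : D) (x y : R).

(** Stated through coordinates, this makes sense for every real [x], with no proof that [x] lies in
    [[0, 1]]. *)
Definition lower x : set D :=
  [set p | (coordinate p < x) || (coordinate p == x) && ~~ side p].

Lemma lower_subset x y : x <= y -> lower x `<=` lower y.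
Proof.
rewrite /lower => + p /=; rewrite le_eqVlt => /orP[/eqP->//|xy].
by move=> /orP[px|/andP[/eqP-> _]]; apply/orP; left => //; exact: lt_trans xy.
Qed.

Lemma lower_open x : 0 <= x <= 1 -> open (lower x).
Proof.
move=> x01; suff -> : lower x = `]-oo, arrow_point x01 true[%classic.
  exact: lray_open.
by apply/seteqP; split => p; rewrite /lower /= in_itv/= arrow_lt !pointE andbT.
Qed.

Lemma lower_closed x : 0 <= x <= 1 -> closed (lower x).
Proof.
move=> x01; suff -> : lower x = `]-oo, arrow_point x01 false]%classic.
  exact: lray_closed.
by apply/seteqP; split => p; rewrite /lower /= in_itv/= arrow_le !pointE implybF.
Qed.

Lemma lower_regopen x : 0 <= x <= 1 -> regopen (lower x).
Proof.
move=> x01; rewrite /regopen -(proj1 (closure_id _) (lower_closed x01)).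
exact/(proj1 (interior_id _))/lower_open.
Qed.

(** The intersection may also contain [(x, 1)], but not in its interior: since [x < 1], each
    neighbourhood of [(x, 1)] contains some [(y, 0)] with [x < y], and this point is outside
    [lower (u n)] once [u n < y]. *)
Lemma interior_bigcap_lower x (u : nat -> R) : 0 <= x < 1 ->
  (forall n, x <= u n) -> (forall y, x < y -> exists n, u n < y) ->
  (\bigcap_n lower (u n))° = lower x.
Proof.
move=> x01 xu ux; have x01' : 0 <= x <= 1 by lra.
apply/seteqP; split; last first.
  rewrite -open_subsetE; last exact: lower_open.
  by move=> p xp n _; exact: lower_subset xp.
move=> p Wp; have px : coordinate p <= x.
  rewrite leNgt; apply/negP => /ux[n unp].
  have /orP[|/andP[/eqP + _]] := interior_subset Wp n I; lra.
rewrite /lower/=; move: px; rewrite le_eqVlt => /orP[/eqP px|->//].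
rewrite px eqxx ltxx/=; apply/negP => sp.
have l01 : 0 <= (1 : R) <= 1 by lra.
have [|w pw wW] := nbhs_sub_itvco (q := arrow_point l01 true) Wp.
  by rewrite arrow_lt !pointE px; case/andP: x01 => _ ->.
have xw : x < coordinate w by move: pw; rewrite arrow_lt px sp/= andbF orbF.
have [y [xy yw]] : exists y, x < y /\ y < coordinate w.
  by exists ((x + coordinate w) / 2); split; lra.
have y01 : 0 <= y <= 1 by have := coordinate01 w; lra.
have /wW yW : `[p, w[%classic (arrow_point y01 false).
  by rewrite /= in_itv/= arrow_le arrow_lt !pointE px xy yw.
have [n uny] := ux _ xy.
by have /orP[|/andP[/eqP + _]] := yW n I; rewrite pointE; lra.
Qed.

Lemma well_order_leq : well_order leq.
Proof.
apply: antisymmetric_well_order; first exact: anti_leq.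
move=> A Ane; have exA : exists n, A n by [].
by exists (ex_minn exA); case: ex_minnP => n An nmin; split => // m /nmin.
Qed.

Lemma inf_continuous_lower (f : set D -> D -> R) :
  ro_positive f -> ro_family f -> ro_inf_continuous f ->
  forall p c, coordinate p < 1 -> side p -> 0 < c ->
  exists2 y, coordinate p < y <= 1 & f (lower y) p < c.
Proof.
move=> fpos ffam finf p c p1 sp c0.
have p01 := coordinate01 p; move px : (coordinate p) p1 p01 => x p1 p01.
(* The sequence starts at [1] and decreases to [x] without leaving []x, 1]]. *)
pose u n := x + (1 - x) * n.+1%:R^-1.
have u01 n : x < u n <= 1.
  have n0 : (0 : R) < n.+1%:R^-1 by rewrite invr_gt0.
  have n1 : n.+1%:R^-1 <= (1 : R) by rewrite invf_le1// ler1n.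
  by rewrite /u; move: n.+1%:R^-1 n0 n1 => t; nra.
have W : (\bigcap_n lower (u n))° = lower x.
  apply: interior_bigcap_lower; [lra|by move=> n; have := u01 n; lra|].
  move=> y xy; have yx0 : 0 < y - x by lra.
  have [N _ /(_ N (leqnn _)) /= Ny] := near_infty_natSinv_lt (PosNum yx0).
  exists N; have N0 : (0 : R) <= N.+1%:R^-1 by rewrite invr_ge0.
  by rewrite /u; move: N.+1%:R^-1 N0 Ny => t; nra.
have regu n : regopen (lower (u n)) by apply: lower_regopen; have := u01 n; lra.
have umono m n : (m <= n)%N -> lower (u n) `<=` lower (u m).
  move=> mn; apply: lower_subset; rewrite /u lerD2l ler_wpM2l//; first by lra.
  by rewrite lef_pV2 ?posrE// ler_nat.
have rx : regopen (lower x) by exact: lower_regopen.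
(* Here [p] is [(x, 1)], the first point outside [lower x], so positivity exactly on [lower x]
   forces the value [0]. *)
have fx0 : f (lower x) p = 0.
  have /andP[fx0 fx1] : 0 <= f (lower x) p <= 1.
    by have := ffam _ rx p; rewrite in_itv.
  apply/eqP; rewrite eq_le fx0 andbT leNgt; apply/negP => fp.
  have : (f (lower x) @^-1` `]0, 1]) p by rewrite /= in_itv/= fp.
  by rewrite -fpos// /lower/= px ltxx eqxx sp.
have := finf _ _ _ (inhabits 0%N) well_order_leq regu umono p.
rewrite W fx0 => inf0.
have [||_ [n _ <-] fn] := @inf_lt R (range (fun n => f (lower (u n)) p)) c.
- by exists (f (lower (u 0%N)) p), 0%N.
- by rewrite -inf0.
- by exists (u n).
Qed.

Theorem double_arrow_not_kappa_metrizable :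
  ~ kappa_metrizable R (double_arrow R).
Proof.
move=> [_ _ [f [ffam fpos fmono fcont finf]]].
(* All parameters are rational, so that triples form a countable type. For [x < y] sharing a triple,
   the third clause for [y] and the fourth for [x] conflict at [(x, 1)]. *)
pose P (x : R) (t : rat * rat * rat) := let: (c, q, r) := t in
  [/\ ratr q < x, x < (ratr r : R) <= 1,
      forall p, ratr q < coordinate p -> lower x p -> ratr c < f (lower x) p &
      forall p, coordinate p = x -> side p -> f (lower (ratr r)) p < ratr c].
have [x [y [[[c q] r] [x01 y01 xy [qx _ _ fr] [_ /andP[yr r1] fy _]]]]] :
    exists x y t, [/\ 0 < x < 1, 0 < y < 1, x < y, P x t & P y t]; last first.
  have x01' : 0 <= x <= 1 by lra.
  have := fr (arrow_point x01' true) erefl erefl.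
  have := fy (arrow_point x01' true) qx.
  rewrite {1}/lower/= pointE xy => /(_ isT).
  have := fmono (lower y) (lower (ratr r)) _ _ (lower_subset (ltW yr))
            (arrow_point x01' true).
  have ry : regopen (lower y) by apply: lower_regopen; lra.
  have rr : regopen (lower (ratr r)) by apply: lower_regopen; lra.
  by move=> /(_ ry rr); lra.
apply: uncountable_itv01_choice => x x01; have x01' : 0 <= x <= 1 by lra.
have rx := lower_regopen x01'.
have lx : lower x (arrow_point x01' false) by rewrite /lower/= pointE eqxx orbT.
have fx0 : 0 < f (lower x) (arrow_point x01' false).
  by move: lx; rewrite {1}(fpos _ rx)/= in_itv/= => /andP[].
(* The bound [c] is taken below the value at [(x, 0)], the last point of [lower x]; continuity there
   extends it to an interval on the left, from which [q] is obtained. *)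
have [c] := rat_in_itvoo fx0; rewrite in_itv/= => /andP[c0 cf].
have nc : nbhs (arrow_point x01' false) [set p | ratr c < f (lower x) p].
  exact: (@cvgr_gt _ _ _ _ _ _ (fcont _ rx (arrow_point x01' false)) _ cf).
have l01 : 0 <= (0 : R) <= 1 by lra.
have [|w wx wf] := nbhs_sub_itvoc (q := arrow_point l01 false) nc.
  by rewrite arrow_lt !pointE; case/andP: x01 => ->.
have {}wx : coordinate w < x by move: wx; rewrite arrow_lt !pointE/= !andbF orbF.
have [q] := rat_in_itvoo wx; rewrite in_itv/= => /andP[wq qx].
have [|y /andP[xy y1] fy] := inf_continuous_lower (p := arrow_point x01' true)
  fpos ffam finf _ isT c0; first by rewrite pointE; lra.
have [r] := rat_in_itvoo xy; rewrite in_itv/= pointE => /andP[xr ry].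
exists (c, q, r); split => //; first by rewrite xr; lra.
- move=> p qp xp; apply: wf; rewrite /= in_itv/= arrow_lt arrow_le !pointE.
  by rewrite (lt_trans wq qp)/= implybF.
- move=> p px sp; have -> : p = arrow_point x01' true by exact: arrow_eq.
  apply: le_lt_trans fy; apply: fmono.
  + by apply: lower_regopen; rewrite pointE in xy; lra.
  + by apply: lower_regopen; rewrite pointE in xy; lra.
  + by apply: lower_subset; lra.
Qed.

End not_kappa_metrizable.

Theorem mainTheorem7 (R : realType) :
  ro_stratifiable R (double_arrow R) /\ ~ kappa_metrizable R (double_arrow R).
Proof.
split; first exact: double_arrow_ro_stratifiable.
exact: double_arrow_not_kappa_metrizable.
Qed.
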